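(* A stationary random vector field $v$ on $\mathbb{Z}$ cannot satisfy the condition $\mathbb{P}\big( (\operatorname{div} v)_0 > 0 \big) = 1$.
   Context: The lattice $\mathbb{Z}$ is treated as an infinite graph with edges joining $x$ and $x+1$ for $x\in\mathbb{Z}$. A vector field on this graph is a real-valued function on oriented edges whose sum over the two orientations of an edge vanishes; it is thus given by $v = (v_{x,x+1})_{x \in \mathbb{Z}}$ with real values (and $v_{x+1,x} = -v_{x,x+1}$). Its divergence is $(\operatorname{div} v)_x = v_{x,x+1} - v_{x-1,x}$ for $x \in \mathbb{Z}$. A random vector field is a random element of the space of vector fields (with the product $\sigma$-algebra). It is stationary if it is shift-invariant in distribution: for every $z\in\mathbb{Z}$, $(v_{x+z,x+z+1})_{x\in\mathbb{Z}}$ has the same distribution as $(v_{x,x+1})_{x\in\mathbb{Z}}$. No moment assumptions are made. *)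

(* Defs.v *)
From HB Require Import structures.
From mathcomp Require Import all_boot all_order all_algebra.
From mathcomp Require Import all_classical all_reals all_analysis.

Set Implicit Arguments.
Unset Strict Implicit.
Unset Printing Implicit Defensive.

Import Order.TTheory GRing.Theory Num.Theory.
Import numFieldNormedType.Exports.

Local Open Scope classical_set_scope.
Local Open Scope ring_scope.

(* The graph Z: an oriented edge is an ordered pair of neighbours. *)
Record oriented_edge := OrientedEdge {
  tail : int;
  head : int;
  edge_adj : (head == tail + 1) || (tail == head + 1) }.

Lemma fwd_subproof (x : int) : (x + 1 == x + 1) || (x == x + 1 + 1).
Proof. by rewrite eqxx. Qed.

(* The oriented edge (x, x + 1). *)
Definition fwd (x : int) : oriented_edge := OrientedEdge (fwd_subproof x).

Lemma rev_subproof (e : oriented_edge) :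
  (tail e == head e + 1) || (head e == tail e + 1).
Proof. by rewrite orbC edge_adj. Qed.

Definition rev_edge (e : oriented_edge) : oriented_edge :=
  OrientedEdge (rev_subproof e).

Lemma translate_subproof (z : int) (e : oriented_edge) :
  (head e + z == tail e + z + 1) || (tail e + z == head e + z + 1).
Proof. by rewrite ![_ + z + 1]addrAC !(inj_eq (addIr z)) edge_adj. Qed.

Definition translate_edge (z : int) (e : oriented_edge) : oriented_edge :=
  OrientedEdge (translate_subproof z e).

Record vector_field (R : realType) := VectorField {
  vf_val :> oriented_edge -> R;
  vf_antisym : forall e, vf_val e + vf_val (rev_edge e) = 0 }.

Lemma translate_rev (z : int) (e : oriented_edge) :
  translate_edge z (rev_edge e) = rev_edge (translate_edge z e).
Proof. by congr OrientedEdge; exact: bool_irrelevance. Qed.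

Lemma shift_subproof (R : realType) (z : int) (v : vector_field R) e :
  v (translate_edge z e) + v (translate_edge z (rev_edge e)) = 0.
Proof. by rewrite translate_rev vf_antisym. Qed.

(* The field (x, y) |-> v_{x + z, y + z}. *)
Definition vf_shift (R : realType) (z : int) (v : vector_field R) :
    vector_field R :=
  VectorField (shift_subproof z v).

Definition div (R : realType) (v : vector_field R) (x : int) : R :=
  v (fwd x) - v (fwd (x - 1)).

Lemma vf_zero_subproof (R : realType) (e : oriented_edge) : 0 + 0 = 0 :> R.
Proof. exact: addr0. Qed.

Definition vf_zero (R : realType) : vector_field R :=
  VectorField (@vf_zero_subproof R).

HB.instance Definition _ (R : realType) := gen_eqMixin (vector_field R).
HB.instance Definition _ (R : realType) := gen_choiceMixin (vector_field R).
HB.instance Definition _ (R : realType) :=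
  isPointed.Build (vector_field R) (vf_zero R).

(* The sets {v | v_e \in B}, for e an oriented edge and B a Borel set; they
   generate the product sigma-algebra. *)
Definition cylinder (R : realType) : set (set (vector_field R)) :=
  \bigcup_(e in [set: oriented_edge])
    preimage_set_system setT (fun v : vector_field R => v e) measurable.

HB.instance Definition _ (R : realType) :=
  Measurable.copy (vector_field R) (g_sigma_algebraType (@cylinder R)).

(* Laws are compared on measurable sets only: the measures of the library are
   total functions on all sets, whose values elsewhere carry no meaning. *)
Definition stationary (R : realType) (d : measure_display)
    (T : measurableType d) (P : probability T R)
    (v : {RV P >-> vector_field R}) : Prop :=
  forall (z : int) (A : set (vector_field R)), measurable A ->
    pushforward P (vf_shift z \o v) A = pushforward P v A.

(* Main.v *)
Require Import Defs.
From mathcomp Require Import all_boot all_order all_algebra.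
From mathcomp Require Import all_classical all_reals all_analysis.

(** The divergence at [0] is [X - Y], where [X] and [Y] are the values of the
    field on the edges [(0, 1)] and [(-1, 0)].  By stationarity [X] and [Y] have
    the same law, and two variables with the same law cannot satisfy [Y < X]
    almost surely, whether or not they are integrable
    ([equal_cdf_not_ae_lt]): the events [X <= q] and [Y <= q] are almost surely
    nested and have the same probability, so no [q] separates [Y] from [X] with
    positive probability; but when [Y < X] some rational [q] does. *)

Import Order.TTheory GRing.Theory Num.Theory.

Local Open Scope classical_set_scope.
Local Open Scope ring_scope.

Lemma oriented_edge_eq (e f : oriented_edge) :
  tail e = tail f -> Defs.head e = Defs.head f -> e = f.
Proof.
case: e f => [a b p] [a' b' p'] /= eqa eqb; subst a' b'.
by congr OrientedEdge; exact: bool_irrelevance.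
Qed.

Lemma translate_fwd (z x : int) : translate_edge z (fwd x) = fwd (x + z).
Proof. by apply: oriented_edge_eq => //=; rewrite addrAC. Qed.

Lemma measurable_vf_eval (R : realType) (e : oriented_edge) :
  measurable_fun setT (fun u : vector_field R => u e).
Proof.
by move=> _ B mB; apply: sub_sigma_algebra; exists e => //; exists B.
Qed.

Section same_law.
Context {R : realType} {d : measure_display} {T : measurableType d}.
Context (P : probability T R) (X Y : T -> R).
Hypotheses (mX : measurable_fun setT X) (mY : measurable_fun setT Y).

Let measurable_le (Z : T -> R) (q : R) : measurable_fun setT Z ->
  measurable [set w | Z w <= q].
Proof.
move=> mZ; rewrite -[X in measurable X]setTI.
by apply: measurable_fun_le => //; exact: measurable_cst.
Qed.

(** Both events have the same probability as [X <= q] and [Y <= q] minus their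
    intersection. *)
Lemma equal_cdf_crossing (q : R) :
  P [set w | X w <= q] = P [set w | Y w <= q] ->
  P ([set w | Y w <= q] `\` [set w | X w <= q]) =
  P ([set w | X w <= q] `\` [set w | Y w <= q]).
Proof.
move=> eq_q; have mXq := measurable_le _ q mX; have mYq := measurable_le _ q mY.
have Poo A : measurable A -> (P A < +oo)%E.
  by move=> mA; rewrite ltey_eq fin_num_measure.
rewrite !measureD ?Poo// setIC.
by congr (_ - _)%E; exact: esym.
Qed.

Lemma equal_cdf_not_ae_lt :
  (forall q, P [set w | X w <= q] = P [set w | Y w <= q]) ->
  P [set w | Y w < X w] <> 1%E.
Proof.
move=> eq_cdf PYX.
have mYX : measurable [set w | Y w < X w].
  rewrite (_ : mkset _ = ~` [set w | X w <= Y w]); last first.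
    by apply/seteqP; split=> w /=; rewrite ltNge => /negP.
  apply: measurableC; rewrite -[X in measurable X]setTI.
  exact: measurable_fun_le.
have null_compl : P (~` [set w | Y w < X w]) = 0%E.
  by rewrite probability_setC // PYX subee.
have null_sep q : P ([set w | Y w <= q] `\` [set w | X w <= q]) = 0%E.
  (* The opposite crossing X <= q < Y takes place where Y < X fails. *)
  rewrite equal_cdf_crossing //.
  apply: subset_measure0 null_compl; first 2 last.
  - by move=> w [/= Xq /negP]; rewrite -ltNge => qY; apply/negP;
      rewrite -leNgt (le_trans Xq) // ltW.
  - by apply: measurableD; exact: measurable_le.
  - exact: measurableC.
(* An enumeration of the rationals, repeating 0 at the non-codes. *)
pose enum_rat n : R := ratr (odflt 0 (unpickle n : option rat)).
have sep_cover : [set w | Y w < X w] `<=`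
    \bigcup_n ([set w | Y w <= enum_rat n] `\` [set w | X w <= enum_rat n]).
  move=> w /= /rat_in_itvoo[q]; rewrite in_itv /= => /andP[Yq qX].
  exists (pickle q) => //; rewrite /enum_rat pickleK /=.
  by split => /=; [exact: ltW | apply/negP; rewrite -ltNge].
have null_lt : P.-negligible [set w | Y w < X w].
  apply: negligibleS sep_cover _.
  apply: negligible_bigcup => n; apply/negligibleP; last exact: null_sep.
  by apply: measurableD; exact: measurable_le.
have {null_lt} PYX0 := (negligibleP P mYX).1 null_lt.
by have /eqP := etrans (esym PYX) PYX0; rewrite onee_eq0.
Qed.

End same_law.

Theorem mainTheorem2 (R : realType) (d : measure_display)
    (T : measurableType d) (P : probability T R)
    (v : {RV P >-> vector_field R}) :
  stationary v -> ~ (P [set w | 0 < div (v w) 0] = 1%E).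
Proof.
move=> stat_v.
have mv e : measurable_fun setT (fun w => v w e).
  by apply: measurableT_comp (measurable_vf_eval R e) _; exact: measurable_funPT.
have -> : [set w | 0 < div (v w) 0] =
    [set w | v w (fwd (0 - 1)) < v w (fwd 0)].
  by apply/seteqP; split=> w /=; rewrite /div subr_gt0.
apply: equal_cdf_not_ae_lt => // q.
(* Stationarity for the shift by -1, which moves the edge (0, 1) to (-1, 0),
   applied to the half-space of fields whose value on (0, 1) is at most q. *)
have mle : measurable [set u : vector_field R | u (fwd 0) <= q].
  rewrite -[X in measurable X]setTI; apply: measurable_fun_le => //.
  exact: measurable_vf_eval.
have -> : [set w | v w (fwd (0 - 1)) <= q] =
    (vf_shift (- 1) \o v) @^-1` [set u | u (fwd 0) <= q].
  by apply/seteqP; split=> w /=; rewrite translate_fwd.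
exact/esym/(stat_v (- 1) _ mle).
Qed.
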